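(* Let $G$ be a graph having a looped vertex $v$. Then $\ker(G)$, $\ker(G*v)$, and $\ker(G+v)$ are such that precisely two of the three are equal, to say $K_1$, and the third, $K_2$, is such that $\dim(K_2)=\dim(K_1)+1$ and $K_1=\{X\in K_2\mid v\notin X\}$.
   Context: Graphs are finite and undirected, without parallel edges, but loops are allowed. A graph $G$ with vertex set $V$ is identified with its adjacency matrix, the symmetric $V\times V$ matrix $(a_{u,w})$ over $\mathbb{F}_2$ with $a_{u,w}=1$ iff $\{u,w\}$ is an edge (where $a_{u,u}=1$ iff $u$ has a loop). $\ker(G)$ is the null space over $\mathbb{F}_2$ of this adjacency matrix; vectors over $\mathbb{F}_2$ indexed by $V$ are identified with subsets of $V$ (their supports), so $\ker(G)$ is regarded as a family of subsets of $V$. $G+v$ (loop complementation on $v$) is the graph obtained from $G$ by toggling the presence of a loop at $v$. For a looped vertex $v$, $G*v$ (pivot, i.e., local complementation at $v$) is the graph obtained from $G$ by toggling adjacency among the neighbours of $v$: with $N_G(v)=\{w\in V\mid \{v,w\}\in E(G),\ w\neq v\}$, for all $x,y\in N_G(v)$ (with $x=y$ possible, so loops on neighbours are toggled as well), $\{x,y\}$ is an edge of $G*v$ iff $\{x,y\}$ is not an edge of $G$; all other edges and loops are left unchanged. *)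

(* Defs.v *)
From HB Require Import structures.
From mathcomp Require Import all_boot all_order all_algebra.

Set Implicit Arguments.
Unset Strict Implicit.
Unset Printing Implicit Defensive.

Import GRing.Theory.
Local Open Scope ring_scope.

(* [adj] is not required to be irreflexive: [adj G u u] means that [u] is
   looped. *)
Record graph (V : finType) := Graph {
  adj :> rel V;
  adj_sym : symmetric adj
}.

Section Operations.
Variables (V : finType) (G : graph V) (v : V).

Definition looped : bool := G v v.

Definition nbhd : {set V} := [set w | G v w && (w != v)].

Definition loopc_adj : rel V :=
  fun x y => G x y (+) ((x == v) && (y == v)).

Fact loopc_adj_sym : symmetric loopc_adj.
Proof. by move=> x y; rewrite /loopc_adj adj_sym andbC. Qed.

Definition loopc : graph V := Graph loopc_adj_sym.

Definition pivot_adj : rel V :=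
  fun x y => G x y (+) ((x \in nbhd) && (y \in nbhd)).

Fact pivot_adj_sym : symmetric pivot_adj.
Proof. by move=> x y; rewrite /pivot_adj adj_sym andbC. Qed.

(* Only meaningful when [v] is looped. *)
Definition pivot : graph V := Graph pivot_adj_sym.

End Operations.

(* Rows and columns are indexed by [V] through [enum_val : 'I_#|V| -> V]. *)
Definition adjmx (V : finType) (G : graph V) : 'M['F_2]_#|V| :=
  \matrix_(i, j) (G (enum_val i) (enum_val j))%:R.

Definition ker (V : finType) (G : graph V) : {vspace 'cV['F_2]_#|V|} :=
  lker (linfun (mulmx (adjmx G) : 'cV['F_2]_#|V| -> 'cV['F_2]_#|V|)).

(* The identification of vectors over F_2 with subsets of [V]: [charvec X] is
   the unique vector with support [X]. *)
Definition charvec (V : finType) (X : {set V}) : 'cV['F_2]_#|V| :=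
  \col_i (enum_val i \in X)%:R.

Definition supports (V : finType) (K : {vspace 'cV['F_2]_#|V|}) :
    {set {set V}} :=
  [set X | charvec X \in K].

(* The inequality is part of "precisely two of the three are equal". *)
Definition two_equal (V : finType) (v : V)
    (K K' K2 : {vspace 'cV['F_2]_#|V|}) : Prop :=
  [/\ K = K',
      K <> K2,
      \dim K2 = (\dim K + 1)%N
    & supports K = [set X in supports K2 | v \notin X]].

(* Main.v *)
Require Import Defs.
From mathcomp Require Import all_boot all_order all_algebra.

(** Let [A] be the adjacency matrix, [e] the unit vector of [v] and [a = A e].
    A vector [x] lies in [ker G], [ker (G+v)], [ker (G*v)] iff [A x] is [0],
    [x_v e], [x_v (a + e)] respectively (for [G*v], row [v] of the equation
    forces [(A x)_v = 0], because [v] is looped).  The three kernels thus have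
    the same elements with [x_v = 0], and it remains to see that exactly one of
    them has an element with [x_v = 1].  By symmetry of [A], [e] is in the image
    of [A] iff no [x] in [ker G] has [x_v = 1].  In that case all solutions of
    [A y = e] have the same [y_v]: if [y_v = 1] then [y] is in [ker (G+v)],
    and if [y_v = 0] then [y + e] is in [ker (G*v)]. *)

Set Implicit Arguments.
Unset Strict Implicit.
Unset Printing Implicit Defensive.

Import GRing.Theory.
Local Open Scope ring_scope.

Lemma F2_neq0 (x : 'F_2) : x != 0 -> x = 1.
Proof. by case: x => [[|[|m]]] // ltm _; apply: val_inj. Qed.

Lemma addF2mx_self m n (A : 'M['F_2]_(m, n)) : A + A = 0.
Proof.
apply/matrixP=> i j; rewrite !mxE; case: (A i j) => [[|[|k]]] // ltk.
  exact: val_inj.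
exact: val_inj.
Qed.

Lemma addF2mx_eq0 m n (A B : 'M['F_2]_(m, n)) : (A + B == 0) = (A == B).
Proof.
by rewrite addr_eq0; have /eqP := addF2mx_self B; rewrite addr_eq0 => /eqP<-.
Qed.

Lemma natr_addb (b c : bool) : (b (+) c)%:R = b%:R + c%:R :> 'F_2.
Proof. by case: b; case: c; apply: val_inj. Qed.

Lemma mem_ker (V : finType) (G : graph V) x :
  (x \in ker G) = (adjmx G *m x == 0).
Proof. by rewrite memv_ker lfunE. Qed.

Section Kernels.
Variables (V : finType) (v : V).
Local Notation vec := 'cV['F_2]_#|V|.
Local Notation iv := (enum_rank v).
Local Notation e := (delta_mx iv 0 : vec).

(** Since [x - x_v z] has coordinate 0 at [v], it lies in [K] for every [x] in [K2]; hence [K2] is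
    the direct sum of [K] and the line spanned by [z]. *)
Lemma two_equalI (K K' K2 : {vspace vec}) (z : vec) :
    (forall x : vec, x iv 0 = 0 -> (x \in K') = (x \in K)) ->
    (forall x : vec, x iv 0 = 0 -> (x \in K2) = (x \in K)) ->
    (forall x : vec, x \in K -> x iv 0 = 0) ->
    (forall x : vec, x \in K' -> x iv 0 = 0) ->
    z \in K2 -> z iv 0 = 1 ->
  two_equal v K K' K2.
Proof.
move=> eqK' eqK2 K0 K'0 zK2 zv.
have zK : z \notin K by apply/negP=> /K0/eqP; rewrite zv oner_eq0.
have subK : (K <= K2)%VS by apply/subvP=> x xK; rewrite eqK2 // K0.
split.
- apply/vspaceP=> x; apply/idP/idP=> xK; first by rewrite eqK' // K0.
  by rewrite -eqK' // K'0.
- by move=> eqK; rewrite eqK zK2 in zK.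
- have -> : K2 = (K + <[z]>)%VS.
    apply/eqP; rewrite eqEsubv subv_add subK -memvE zK2 !andbT.
    apply/subvP=> x xK2; apply/memv_addP; exists (x - x iv 0 *: z).
      by rewrite -eqK2 ?rpredB ?rpredZ // !mxE zv mulr1 subrr.
    by exists (x iv 0 *: z); rewrite ?rpredZ ?memv_line // subrK.
  rewrite dimv_disjoint_sum ?dim_vline.
    by have [z0|//] := eqVneq z 0; rewrite z0 mem0v in zK.
  apply/eqP; rewrite -subv0; apply/subvP=> x.
  rewrite memv_cap => /andP[xK /vlineP[k xkz]]; move: (K0 _ xK).
  by rewrite xkz mxE zv mulr1 => ->; rewrite scale0r mem0v.
- apply/setP=> X; rewrite !inE.
  have Xv : charvec X iv 0 = (v \in X)%:R by rewrite mxE enum_rankK.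
  case: (boolP (v \in X)) Xv => /= _ Xv; last by rewrite andbT eqK2.
  by rewrite andbF; apply/negP=> /K0/eqP; rewrite Xv oner_eq0.
Qed.

Variable G : graph V.
Local Notation A := (adjmx G).

Lemma trmx_adjmx : A^T = A.
Proof. by apply/matrixP=> i j; rewrite !mxE adj_sym. Qed.

Lemma mul_delta_col (c x : vec) : c *m e^T *m x = x iv 0 *: c.
Proof.
rewrite -mulmxA trmx_delta -rowE; apply/matrixP=> i j.
by rewrite !mxE big_ord1 !mxE !ord1 mulrC.
Qed.

(** Toggling the loop adds the rank-one matrix [e e^T] to [A], and signs vanish over [F_2]. *)
Lemma mem_ker_loopc (x : vec) :
  (x \in ker (loopc G v)) = (A *m x == x iv 0 *: e).
Proof.
have -> : (x \in ker (loopc G v)) = ((A + e *m e^T) *m x == 0).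
  rewrite mem_ker; congr (_ *m x == 0); apply/matrixP=> i j.
  rewrite !mxE big_ord1 !mxE natr_addb -!(can_eq enum_valK) enum_rankK.
  by rewrite eqxx !andbT -natrM mulnb.
by rewrite mulmxDl mul_delta_col addF2mx_eq0.
Qed.

Hypothesis hv : looped G v.

(** Pivoting adds [n n^T] to [A], where [n] is the characteristic vector of the neighbourhood of
    [v]. *)
Lemma mem_ker_pivot (x : vec) :
  (x \in ker (pivot G v)) = (A *m x == x iv 0 *: (A *m e + e)).
Proof.
pose n : vec := A *m e + e.
(* Column [v] of [A] marks the neighbours of [v] and, because of the loop, [v] itself; adding [e]
   removes [v]. *)
have nE i : n i 0 = (enum_val i \in nbhd G v)%:R.
  rewrite /n -colE !mxE enum_rankK inE adj_sym eqxx andbT.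
  rewrite -(inj_eq enum_val_inj) enum_rankK.
  have [->|_] := eqVneq (enum_val i) v; last by rewrite andbT addr0.
  by rewrite andbF [G v v]hv; apply: val_inj.
have -> : (x \in ker (pivot G v)) = (A *m x == (n^T *m x) 0 0 *: n).
  rewrite -addF2mx_eq0 -mul_mx_scalar -mx11_scalar mulmxA -mulmxDl mem_ker.
  congr (_ *m x == 0); apply/matrixP=> i j.
  by rewrite !mxE big_ord1 [_^T _ _]mxE !nE natr_addb -natrM mulnb.
have nxE : (n^T *m x) 0 0 = (A *m x) iv 0 + x iv 0.
  rewrite /n linearD /= trmx_mul trmx_adjmx mulmxDl -mulmxA trmx_delta -!rowE.
  by rewrite !mxE.
have nv : n iv 0 = 0 by rewrite nE enum_rankK inE eqxx andbF.
rewrite nxE -/n.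
(* As [n_v = 0], row [v] of either equation gives [(A x)_v = 0], so the two coefficients of [n]
   agree. *)
apply/eqP/eqP=> Ax.
  have Axv : (A *m x) iv 0 = 0 by rewrite Ax mxE nv mulr0.
  by rewrite {1}Ax Axv add0r.
by rewrite {2}Ax mxE nv mulr0 add0r.
Qed.

(* A column of [cokermx A] not orthogonal to [e] is the kernel vector. *)
Lemma unit_image_or_ker :
  (exists y : vec, A *m y = e) \/ (exists2 x : vec, x \in ker G & x iv 0 = 1).
Proof.
have [/submxP[u eu]|] := boolP (e^T <= A)%MS.
  by left; exists u^T; rewrite -{1}trmx_adjmx -trmx_mul -eu trmxK.
rewrite submxE trmx_delta -rowE => /rV0Pn[j]; rewrite mxE => nz; right.
exists (col j (cokermx A)); last by rewrite mxE; apply: F2_neq0.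
by rewrite mem_ker colE mulmxA mulmx_coker mul0mx.
Qed.

(* Symmetry: [x_v = e^T x = y^T A x = 0]. *)
Lemma ker_coord0 (x y : vec) : A *m y = e -> A *m x = 0 -> x iv 0 = 0.
Proof.
move=> Ay Ax; have := congr1 (mulmx^~ x) (congr1 trmx Ay).
rewrite trmx_mul trmx_adjmx -mulmxA Ax mulmx0 trmx_delta -rowE.
by move/matrixP/(_ 0 0); rewrite !mxE => <-.
Qed.

End Kernels.

Theorem theorem7p1 (V : finType) (G : graph V) (v : V) (hv : looped G v) :
  [\/ two_equal v (ker G) (ker (pivot G v)) (ker (loopc G v)),
      two_equal v (ker G) (ker (loopc G v)) (ker (pivot G v))
    | two_equal v (ker (pivot G v)) (ker (loopc G v)) (ker G)].
Proof.
set iv := enum_rank v; pose e : 'cV['F_2]_#|V| := delta_mx iv 0.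
have ev : e iv 0 = 1 by rewrite mxE !eqxx.
have loop0 (x : 'cV_#|V|) : x iv 0 = 0 ->
    (x \in ker (loopc G v)) = (x \in ker G).
  by move=> xv; rewrite [LHS]mem_ker_loopc mem_ker xv scale0r.
have pivot0 (x : 'cV_#|V|) : x iv 0 = 0 ->
    (x \in ker (pivot G v)) = (x \in ker G).
  by move=> xv; rewrite [LHS]mem_ker_pivot // mem_ker xv scale0r.
have loop1 (x : 'cV_#|V|) : x \in ker (loopc G v) ->
    x iv 0 != 0 -> adjmx G *m x = e.
  by rewrite mem_ker_loopc => /eqP-> /F2_neq0->; rewrite scale1r.
have pivot1 (x : 'cV_#|V|) : x \in ker (pivot G v) -> x iv 0 != 0 ->
    adjmx G *m (x + e) = e.
  rewrite (mem_ker_pivot hv) mulmxDr => /eqP-> /F2_neq0->.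
  by rewrite scale1r addrAC addF2mx_self add0r.
have [[y Ay]|[z zK zv]] := unit_image_or_ker v G; last first.
  have nimage (y : 'cV_#|V|) : adjmx G *m y <> e.
    move=> Ay; move: zK; rewrite mem_ker => /eqP/(ker_coord0 Ay)/eqP.
    by rewrite zv oner_eq0.
  (* An element of either other kernel with nonzero coordinate at [v] would put [e] in the image of
     [A]. *)
  apply: Or33; apply: (two_equalI _ _ _ _ zK zv) => x.
  - by move=> xv; rewrite [LHS](loop0 x xv) [RHS](pivot0 x xv).
  - by move=> xv; rewrite [RHS](pivot0 x xv).
  - by move=> xK; apply/eqP/negPn/negP=> /(pivot1 _ xK)/nimage.
  - by move=> xK; apply/eqP/negPn/negP=> /(loop1 _ xK)/nimage.
have ker0 (x : 'cV_#|V|) : x \in ker G -> x iv 0 = 0.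
  by rewrite mem_ker => /eqP; apply: ker_coord0 Ay.
have uniq_coord (w : 'cV_#|V|) : adjmx G *m w = e -> w iv 0 = y iv 0.
  move=> Aw; have /ker0/eqP : w - y \in ker G.
    by rewrite mem_ker mulmxBr Aw Ay subrr.
  by rewrite !mxE subr_eq0 => /eqP.
have [yv|/F2_neq0 yv] := eqVneq (y iv 0) 0.
  (* Here [A (y + e) = A e + e] and [(y + e)_v = 1], which is the pivot equation. *)
  apply: Or32; apply: (two_equalI (z := y + e) loop0 pivot0 ker0).
  - move=> x xK; apply/eqP/negPn/negP=> xv.
    by case/eqP: (xv); rewrite (uniq_coord _ (loop1 _ xK xv)).
  - rewrite mem_ker_pivot // -/iv -/e !mxE yv add0r !eqxx scale1r.
    by rewrite mulmxDr Ay addrC.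
  - by rewrite mxE yv add0r ev.
apply: Or31; apply: (two_equalI (z := y) pivot0 loop0 ker0 _ _ yv).
(* Otherwise [x + e] would solve [A w = e] with coordinate [1 + 1 = 0] at [v], whereas [y_v = 1]. *)
- move=> x xK; apply/eqP/negPn/negP=> xv.
  have := uniq_coord _ (pivot1 _ xK xv).
  by rewrite mxE (F2_neq0 xv) ev yv => /eqP; rewrite -subr_eq0 addrK oner_eq0.
- by rewrite mem_ker_loopc -/iv yv scale1r Ay.
Qed.
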